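(* There is an existential formula $\varphi(x)$ without parameters in the language $\mathcal{L}_{\rm ring}\cup\{P_2^{AS}\}$ such that $\mathcal{O}_K=\varphi(K)$ holds for every Henselian valued field $K$ whose residue field is finite or pseudo-finite.
   Context: $\mathcal{L}_{\rm ring}=(+,-,\cdot,0,1)$ is the language of rings. $P_2^{AS}$ is a unary predicate interpreted in a field by $P_2^{AS}(x)\Leftrightarrow \exists y\,(x=y^2+y)$. A Henselian valued field $K$ has a nontrivial Henselian valuation with valuation ring $\mathcal{O}_K$. A pseudo-finite field is an infinite perfect pseudo-algebraically closed field with exactly one extension of each finite degree. An existential formula is one of the form $\exists y_1\dots\exists y_n\,\psi$ with $\psi$ quantifier-free (possibly containing negated atomic formulas, including negated predicates). $\varphi(K)$ denotes the set of elements of $K$ satisfying $\varphi$. *)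

(* Defs.v *)
From HB Require Import structures.
From mathcomp Require Import all_boot all_order all_algebra all_field.
From mathcomp Require Import ring_quotient generic_quotient.
From mathcomp Require Import mpoly.

Set Implicit Arguments.
Unset Strict Implicit.
Unset Printing Implicit Defensive.

Import Order.TTheory GRing.Theory Num.Theory.
Local Open Scope ring_scope.

(** ** The language of rings with an Artin-Schreier predicate *)

Inductive term (V : Type) : Type :=
| TVar of V
| TZero
| TOne
| TOpp of term V
| TAdd of term V & term V
| TMul of term V & term V.

Inductive qf_formula (V : Type) : Type :=
| QEq of term V & term V
| QAS of term V
| QNot of qf_formula V
| QAnd of qf_formula V & qf_formula V
| QOr of qf_formula V & qf_formula V.

(* The formula [exists y_0 ... y_(n-1), psi] in the single free variable x;
   in psi the variable x is [None] and y_i is [Some i].  Terms contain no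
   constants from a structure, so there are no parameters. *)
Record ex_formula : Type := ExFormula {
  ex_arity : nat;
  ex_matrix : qf_formula (option 'I_ex_arity)
}.

Section Semantics.
Variable K : fieldType.

Definition P2AS (x : K) : Prop := exists y : K, x = y ^+ 2 + y.

Section Env.
Variables (V : Type) (e : V -> K).

Fixpoint term_eval (t : term V) : K :=
  match t with
  | TVar i => e i
  | TZero => 0
  | TOne => 1
  | TOpp s => - term_eval s
  | TAdd s u => term_eval s + term_eval u
  | TMul s u => term_eval s * term_eval u
  end.

Fixpoint qf_holds (f : qf_formula V) : Prop :=
  match f with
  | QEq s t => term_eval s = term_eval t
  | QAS t => P2AS (term_eval t)
  | QNot g => ~ qf_holds g
  | QAnd g h => qf_holds g /\ qf_holds h
  | QOr g h => qf_holds g \/ qf_holds h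
  end.

End Env.

Definition ex_holds (phi : ex_formula) (x : K) : Prop :=
  exists y : 'I_(ex_arity phi) -> K,
    qf_holds (fun i => if i is Some j then y j else x) (ex_matrix phi).

End Semantics.

(** ** Valuations *)

Record orderedZmodType : Type := OrderedZmodType {
  ozmod_sort :> porderZmodType;
  ozmod_total : total (<=%R : rel ozmod_sort);
  ozmod_leD2l : forall z x y : ozmod_sort, x <= y -> z + x <= z + y
}.

(* The usual convention v(0) = infinity is rendered by never using the value
   of v at 0. *)
Record valuation (K : fieldType) (G : orderedZmodType) : Type := Valuation {
  val_fun :> K -> G;
  valuationM : forall x y : K, x != 0 -> y != 0 ->
    val_fun (x * y) = val_fun x + val_fun y;
  valuationD : forall x y : K, x != 0 -> y != 0 -> x + y != 0 ->
    Order.min (val_fun x) (val_fun y) <= val_fun (x + y)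
}.

Section ValuationRing.
Variables (K : fieldType) (G : orderedZmodType) (v : valuation K G).

Definition vring : {pred K} := [pred x | (x == 0) || (0 <= v x)].
Definition vmax : {pred K} := [pred x | (x == 0) || (0 < v x)].

Lemma leD2l (z x y : G) : (z + x <= z + y) = (x <= y).
Proof.
apply/idP/idP => [|]; last exact: ozmod_leD2l.
by move/(@ozmod_leD2l _ (- z)); rewrite !addKr.
Qed.

Lemma vcomparable (x y : G) : x >=< y.
Proof. exact: (ozmod_total x y). Qed.

Lemma val1 : v 1 = 0.
Proof.
have := valuationM v (oner_neq0 K) (oner_neq0 K).
by rewrite mulr1 -[LHS]addr0 => /addrI.
Qed.

Lemma valN1 : v (-1) = 0.
Proof.
have n0 : (-1 : K) != 0 by rewrite oppr_eq0 oner_eq0.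
have := valuationM v n0 n0; rewrite mulrNN mulr1 val1.
case/orP: (ozmod_total 0 (v (-1))) => h e; apply/eqP; rewrite eq_le h ?andbT /=.
  by rewrite -(leD2l (v (-1))) -e addr0.
by rewrite -(leD2l (v (-1))) -e addr0.
Qed.

Lemma valN (x : K) : v (- x) = v x.
Proof.
have [->|x0] := eqVneq x 0; first by rewrite oppr0.
by rewrite -mulN1r valuationM ?valN1 ?add0r // oppr_eq0 oner_eq0.
Qed.

Lemma valV (x : K) : x != 0 -> v x^-1 = - v x.
Proof.
move=> x0; have x'0 : x^-1 != 0 by rewrite invr_eq0.
apply: (addrI (v x)); rewrite -valuationM // divff // val1 subrr //.
Qed.

Lemma vring_subring : subring_closed vring.
Proof.
split=> [|x y|x y]; rewrite !inE ?val1 ?lexx ?orbT //.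
- have [->|x0] := eqVneq x 0; first by rewrite sub0r oppr_eq0 valN.
  have [->|y0] := eqVneq y 0; first by rewrite subr0 (negPf x0).
  have [//|xy0] := eqVneq (x - y) 0; rewrite /= => vx vy.
  have ny0 : - y != 0 by rewrite oppr_eq0.
  apply: le_trans (valuationD v x0 ny0 xy0).
  by rewrite comparable_le_min ?vcomparable // valN vx vy.
- have [->|x0] := eqVneq x 0; first by rewrite mul0r eqxx.
  have [->|y0] := eqVneq y 0; first by rewrite mulr0 eqxx.
  rewrite /= => vx vy; rewrite valuationM //; apply/orP; right.
  by apply: le_trans vx _; rewrite -{1}[v x]addr0 leD2l.
Qed.

HB.instance Definition _ := GRing.isSubringClosed.Build K vring vring_subring.

Record valuation_ring : Type := VRing {
  vring_val : K;
  vring_valP : vring_val \in vring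
}.

HB.instance Definition _ := [isSub for vring_val].
HB.instance Definition _ := [Choice of valuation_ring by <:].
HB.instance Definition _ :=
  [SubChoice_isSubComNzRing of valuation_ring by <:].

Definition vmax_ideal : {pred valuation_ring} :=
  [pred x | vring_val x \in vmax].

Lemma vmax_idealr : idealr_closed vmax_ideal.
Proof.
split=> [||a x y]; first by rewrite !inE /= eqxx.
  by rewrite !inE /= val1 ltxx oner_eq0.
have vmaxM (b c : K) : b \in vring -> c \in vmax -> b * c \in vmax.
  rewrite !inE; have [->|b0] := eqVneq b 0; first by rewrite mul0r eqxx.
  have [->|c0] := eqVneq c 0; first by rewrite mulr0 eqxx.
  rewrite /= => vb vc; rewrite valuationM //; apply/orP; right.
  by apply: lt_le_trans vc _; rewrite addrC -{1}[v c]addr0 leD2l.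
move=> hx hy; have := vmaxM _ _ (vring_valP a) hx; move: hy.
rewrite -[a * x + y \in _]/(vring_val a * vring_val x + vring_val y \in vmax).
rewrite -[y \in _]/(vring_val y \in vmax) !inE.
move: (vring_val a * vring_val x) (vring_val y) => p q.
have [->|p0] := eqVneq p 0; first by rewrite add0r.
have [->|q0] := eqVneq q 0; first by rewrite addr0 (negPf p0).
have [//|pq0] := eqVneq (p + q) 0; rewrite /= => vq vp.
apply: lt_le_trans (valuationD v p0 q0 pq0).
by rewrite comparable_lt_min ?vcomparable // vp vq.
Qed.

HB.instance Definition _ := isIdealr.Build valuation_ring vmax_ideal vmax_idealr.

Definition residue_field : Type := {ideal_quot vmax_ideal}.

HB.instance Definition _ := GRing.ComNzRing.on residue_field.

Definition residue_inv (x : residue_field) : residue_field :=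
  if x == 0 then 0
  else \pi_({ideal_quot vmax_ideal})%qT
         (insubd (0 : valuation_ring) (vring_val (repr x))^-1).

Lemma residue_mulVf (x : residue_field) : x != 0 -> residue_inv x * x = 1.
Proof.
move=> x0; rewrite /residue_inv (negPf x0); move: x0; rewrite -{1 3}[x]reprK.
move: (repr x) => {x} a a0.
have {a0} : a \notin vmax_ideal.
  apply: contraNN a0 => am; rewrite -(rmorph0 \pi_({ideal_quot vmax_ideal})%qT).
  by rewrite -Quotient.idealrBE subr0.
rewrite !inE negb_or -comparable_leNgt ?vcomparable // => /andP [a0 va].
have va' : (vring_val a)^-1 \in vring.
  have := vring_valP a; rewrite !inE (negPf a0) /= invr_eq0 (negPf a0) /= => va'.
  have v0 : v (vring_val a) = 0 by apply/eqP; rewrite eq_le va va'.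
  by rewrite valV // v0 oppr0.
rewrite -[_ * _](rmorphM \pi_({ideal_quot vmax_ideal})%qT).
rewrite -[RHS](rmorph1 \pi_({ideal_quot vmax_ideal})%qT); congr (\pi _)%qT.
apply: val_inj; rewrite /= -[LHS]/(vring_val _ * vring_val a).
by rewrite -[vring_val (insubd _ _)]/(val _) insubdK // mulVf.
Qed.

Lemma residue_inv0 : residue_inv 0 = 0.
Proof. by rewrite /residue_inv eqxx. Qed.

HB.instance Definition _ :=
  GRing.ComNzRing_isField.Build residue_field residue_mulVf residue_inv0.

Definition nontrivial_valuation : Prop := exists2 x : K, x != 0 & v x != 0.

Definition henselian : Prop :=
  forall (f : {poly K}) (a : K),
    f \is a polyOver vring -> a \in vring ->
    f.[a] \in vmax -> f^`().[a] \notin vmax ->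
    exists b : K, [/\ b \in vring, f.[b] = 0 & b - a \in vmax].

End ValuationRing.

(** ** Pseudo-finite fields *)

Definition finite_field (F : fieldType) : Prop :=
  exists s : seq F, forall x : F, x \in s.

Definition perfect_field (F : fieldType) : Prop :=
  forall p : nat, p \in [pchar F] -> forall x : F, exists y : F, y ^+ p = x.

Section PAC.
Variable n : nat.

Definition in_ideal (R : fieldType) (fs : seq {mpoly R[n]}) (p : {mpoly R[n]}) :
    Prop :=
  exists gs : 'I_(size fs) -> {mpoly R[n]},
    p = \sum_(i < size fs) gs i * fs`_i.

Definition prime_ideal (R : fieldType) (fs : seq {mpoly R[n]}) : Prop :=
  ~ in_ideal fs 1 /\
  (forall p q, in_ideal fs (p * q) -> in_ideal fs p \/ in_ideal fs q).

(* The affine scheme cut out by fs is a variety over F (geometrically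
   integral): it is integral after every extension of the base field. *)
Definition abs_prime (F : fieldType) (fs : seq {mpoly F[n]}) : Prop :=
  forall (L : fieldType) (iota : {rmorphism F -> L}),
    prime_ideal [seq map_mpoly iota f | f <- fs].

End PAC.

Definition pac_field (F : fieldType) : Prop :=
  forall (n : nat) (fs : seq {mpoly F[n]}), abs_prime fs ->
    exists a : 'I_n -> F, forall f, f \in fs -> f.@[a] = 0.

(* Exactly one extension of each degree inside an algebraic closure.  Any two
   finite subextensions of an algebraic closure lie in a common finite
   extension E, so uniqueness is equality of subfields of E.  Uniqueness up to
   F-isomorphism would be strictly weaker: the absolute Galois group could then
   be non-procyclic. *)
Definition one_extension_per_degree (F : fieldType) : Prop :=
  forall d : nat, (0 < d)%N ->
    (exists E : fieldExtType F, \dim {: E} = d) /\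
    (forall (E : fieldExtType F) (L1 L2 : {subfield E}),
       \dim L1 = d -> \dim L2 = d -> L1 = L2).

Definition pseudo_finite (F : fieldType) : Prop :=
  [/\ ~ finite_field F, perfect_field F, pac_field F
    & one_extension_per_degree F].

(* Main.v *)
From HB Require Import structures.
Require Import Defs.
From mathcomp Require Import all_boot all_order all_algebra all_field.
From mathcomp Require Import ring_quotient generic_quotient.
From mathcomp Require Import mpoly ring.

(* Let S be the set of inverses of elements outside AS = P2AS(K).  By Hensel's
   lemma the maximal ideal is contained in AS, so S lies in the valuation ring;
   call "good" the elements of S together with 0 and -4.  The valuation ring is
   { s1 + s2 + s3 - s4 : s_i good }.  Indeed, if the residue of s is the
   inverse of an element outside AS(k), k the residue field, then s + x is in S
   for all x in the maximal ideal.  So good elements of k lift, every element of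
   the maximal ideal is a difference of two elements of S, and it remains to see
   that every g in k is a sum of two good elements.
   Fix e in k outside AS(k).  For all t in k the element
     s(t) = (1 + 4e) / (e + t - t^2) - 4 = (1 - 2t)^2 / (e + t - t^2)
   is good.  If k is finite, s is at most two-to-one and avoids -4, so more than
   half of the elements of k are good and pigeonhole applies.  If k is
   pseudo-finite, s(t) + s(r) = g is a plane curve which, in the coordinates t
   and w = r (d N - 1) with N = e + t - t^2 and d = (g + 8) / (1 + 4e), becomes
   a monic quadratic in w that is absolutely irreducible unless g is -4 or -8,
   so it has a rational point. *)

Set Implicit Arguments.
Unset Strict Implicit.
Unset Printing Implicit Defensive.

Import Order.TTheory GRing.Theory.
Local Open Scope ring_scope.

(** * Good elements from a conic, over any field *)

Section GoodElements.
Variable F : fieldType.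
Implicit Types e t s n g : F.

(* [-4] is what [conic e t] becomes at [t = infinity]. *)
Definition good s : Prop :=
  [\/ s = 0, s = - (1 + 1 + 1 + 1) | exists2 n, s * n = 1 & ~ P2AS n].

Definition conic e t : F := (1 + 4 * e) / (e + t - t ^+ 2) - 4.

Lemma nonAS_quad_neq0 e t : ~ P2AS e -> e + t - t ^+ 2 != 0.
Proof.
move=> eP; apply/eqP => h; apply: eP; exists (- t).
by apply/eqP; rewrite -subr_eq0; apply/eqP; rewrite -[RHS]h; ring.
Qed.

Lemma nonAS_disc_neq0 e : ~ P2AS e -> 1 + 4 * e != 0.
Proof.
move=> eP; apply/eqP => h; have [c2|n2] := eqVneq (2 : F) 0.
  have e4 : (4 : F) = 2 * 2 by ring.
  by move/eqP: h; rewrite e4 c2 !mul0r addr0 oner_eq0.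
apply: eP; exists (- 2^-1); apply: (mulfI n2); apply: (mulfI n2).
have -> : 2 * (2 * e) = 1 + 4 * e - 1 by ring.
by rewrite h; field.
Qed.

Lemma good_conic e t : ~ P2AS e -> good (conic e t).
Proof.
move=> eP; have N0 := nonAS_quad_neq0 t eP.
have sE : conic e t = (1 - 2 * t) ^+ 2 / (e + t - t ^+ 2) by rewrite /conic; field.
have [h|h] := eqVneq (1 - 2 * t) 0.
  by apply: Or31; rewrite sE h expr0n mul0r.
apply: Or33; exists ((e + t - t ^+ 2) / (1 - 2 * t) ^+ 2).
  by rewrite sE; field; rewrite N0 h.
(* With [n] this inverse, [1 + 4n = (1 + 4e) / (1 - 2t)^2]: the discriminants of [Y^2 + Y - n] and
   [Y^2 + Y - e] differ by a square, and the witness is the matching affine change of root. *)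
case=> y yE; apply: eP; exists (y * (1 - 2 * t) - t).
have : e + t - t ^+ 2 = (y ^+ 2 + y) * (1 - 2 * t) ^+ 2 by rewrite -yE; field.
by move/eqP; rewrite -subr_eq0 => /eqP h2; apply/eqP; rewrite -subr_eq0 -h2; apply/eqP; ring.
Qed.

Lemma conic_neq e t : ~ P2AS e -> conic e t != - 4.
Proof.
move=> eP; rewrite /conic -subr_eq0 opprK addrNK mulf_neq0 ?nonAS_disc_neq0 //.
by rewrite invr_eq0 nonAS_quad_neq0.
Qed.

Lemma conic_eq e t r : ~ P2AS e -> conic e t = conic e r -> r = t \/ r = 1 - t.
Proof.
move=> eP /addIr /(mulfI (nonAS_disc_neq0 eP)) /invr_inj h.
have : (r - t) * (r - (1 - t)) == 0.
  by apply/eqP; move/eqP: h; rewrite -subr_eq0 => /eqP <-; ring.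
by rewrite mulf_eq0 !subr_eq0 => /orP[] /eqP; [left|right].
Qed.

Lemma goodN4 : good (-4).
Proof. by apply: Or32; congr (- _); ring. Qed.

Definition good_sums : Prop :=
  forall g, exists s1 s2, [/\ good s1, good s2 & g = s1 + s2].

End GoodElements.

(** * Finite residue fields: counting *)

Section FiniteField.
Variable F : fieldType.
Hypothesis finF : finite_field F.

(** [y^2 + y] vanishes at both 0 and -1, so on a finite field it is not injective, hence not
    surjective. *)
Lemma finite_nonAS : exists e : F, ~ P2AS e.
Proof.
have [s0 s0P] := finF; set s := undup s0.
have sP x : x \in s by rewrite mem_undup.
pose f (y : F) := y ^+ 2 + y; set r := map f (rem (-1) s).
have [/allP h|/allPn [e _ eN]] := boolP (all (mem r) s).
  have := uniq_leq_size (undup_uniq s0) h.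
  rewrite size_map size_rem // -/s; case: (s) (sP 0) => //= a l _.
  by rewrite ltnn.
exists e => -[y yE]; move/negP: eN; apply; apply/mapP.
have [y1|y1] := eqVneq y (-1).
  exists 0; last by rewrite yE y1 /f; ring.
  by rewrite mem_rem_uniq ?undup_uniq // inE sP andbT eq_sym oppr_eq0 oner_eq0.
by exists y; rewrite // mem_rem_uniq ?undup_uniq // inE sP andbT.
Qed.

Lemma finite_good_sums : good_sums F.
Proof.
have [s0 s0P] := finF; have [e eP] := finite_nonAS; set s := undup s0 => g.
have us : uniq s := undup_uniq s0.
have sP x : x \in s by rewrite mem_undup.
pose A := undup (map (conic e) s).
have AP t : conic e t \in A by rewrite mem_undup map_f.
have szA : (size s <= size A * 2)%N.
  (* [c] picks one preimage of each value of [conic e]. A fibre has at most two elements, so the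
     value together with a bit determines [t]. *)
  pose c (x : F) := nth 0 s (index x (map (conic e) s)).
  have cP t : conic e (c (conic e t)) = conic e t.
    have h : conic e t \in map (conic e) s by rewrite map_f.
    by rewrite -(nth_map 0 0) ?nth_index // -(size_map (conic e)) index_mem.
  pose phi t := (conic e t, t == c (conic e t)).
  have iphi : injective phi.
    move=> t r [h]; rewrite -h.
    case: eqP => [<-|tN]; case: eqP => // rN _.
    have := conic_eq eP (esym (cP t)); have := conic_eq eP (esym (cP r)).
    rewrite -h => -[/esym//|hr] [/esym//|ht].
    by move: hr; rewrite ht => /(addrI 1) /oppr_inj.
  rewrite -(size_map phi) -[2%N]/(size [:: true; false]) -(size_allpairs pair).
  apply: uniq_leq_size; first by rewrite map_inj_uniq.
  move=> _ /mapP[t _ ->]; apply/allpairsP; exists (phi t); split.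
  - exact: AP.
  - by case: (phi t).2.
  - by [].
(* [conic e] misses [-4], so adding it brings the count strictly above half: [B] and [g - B] must
   meet. *)
pose B := -4 :: A.
have uB : uniq B.
  rewrite /= undup_uniq andbT mem_undup; apply/mapP => -[t _ h].
  by have := conic_neq t eP; rewrite -h eqxx.
have gB x : x \in B -> good x.
  rewrite inE mem_undup => /orP[/eqP->|/mapP[t _ ->]]; first exact: goodN4.
  exact: good_conic.
have [/hasP[x]|/hasPn h] := boolP (has (mem B) (map (fun x => g - x) B)).
  case/mapP=> y yB -> /= gyB; exists y, (g - y); split; try exact: gB.
  by rewrite addrC subrK.
have /uniq_leq_size/(_ (fun x _ => sP x)) : uniq (B ++ map (fun x => g - x) B).
  rewrite cat_uniq uB map_inj_uniq ?uB ?andbT; last first.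
    by move=> x y /addrI/oppr_inj.
  by apply/hasPn.
rewrite size_cat size_map /= -/A => h2.
have := leq_trans h2 szA; rewrite muln2 -addnn addSn ltnNge leq_add2l.
by rewrite leqnSn.
Qed.

End FiniteField.

(** * Elements outside the Artin-Schreier image from a quadratic extension *)

Section QuadraticExtension.
Variables (F : fieldType) (E : fieldExtType F).

(** If [a / b^2 = y^2 + y], then [X^2 - bX - a] splits as [(X + by)(X - by - b)], which forces [x]
    into [F]. *)
Lemma quad_root_nonAS (a b : F) (x : E) : b != 0 ->
  x \notin 1%VS -> x ^+ 2 = a%:A + b%:A * x -> ~ P2AS (a / b ^+ 2).
Proof.
move=> b0 xN xx [y yE]; move/negP: xN; apply.
have aE : a = b ^+ 2 * (y ^+ 2 + y) by rewrite -yE; field.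
have algP (c : F) : c%:A \in (1%VS : {vspace E}) by rewrite rpredZ ?mem1v.
have : (x + (b * y)%:A) * (x - (b * y + b)%:A) == 0.
  apply/eqP; move/eqP: xx; rewrite -subr_eq0 => /eqP <-; rewrite aE.
  rewrite -!in_algE !(rmorphM, rmorphD, rmorphXn) /=; ring.
rewrite mulf_eq0 addr_eq0 subr_eq0 => /orP[/eqP->|/eqP->] //.
by rewrite rpredN.
Qed.

Lemma quadratic_extension_nonAS :
  perfect_field F -> \dim {: E} = 2%N -> exists e : F, ~ P2AS e.
Proof.
move=> perfF dimE.
have [x xN] : exists x : E, x \notin 1%VS.
  have /subvPn [x _ xN] : ~~ ({: E} <= 1)%VS.
    by apply/negP => /dimvS; rewrite dimE dimv1.
  by exists x.
have [a [b xx]] : exists a b : F, x ^+ 2 = a%:A + b%:A * x.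
  have fr : free [:: x; 1].
    by rewrite free_cons seq1_free span_seq1 oner_eq0 xN.
  have : x ^+ 2 \in <<[:: x; 1%R]>>%VS.
    suff /eqP-> : (<<[:: x; 1%R]>> == {: E})%VS by rewrite memvf.
    by rewrite eqEdim subvf dimE; move: fr; rewrite /free => /eqP->.
  rewrite span_cons span_seq1 => /memv_addP[_ /vlineP[b ->]] [_ /vlineP[a ->]] h.
  by exists a, b; rewrite h addrC mulr_algl.
have [b0|b0] := eqVneq b 0; last by exists (a / b ^+ 2); apply: quad_root_nonAS xx.
(* Now [x^2 = a]. In characteristic 2, perfectness gives [a = r^2], so [x = r] lies in [F]. *)
have [c2|c2] := eqVneq (2 : F) 0.
  have [|r rE] := perfF 2%N _ a; first by rewrite inE /= c2 eqxx.
  case/negP: xN; have : (x - r%:A) ^+ 2 = 0.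
    have c2' : (2 : E) = 0 by rewrite -[2](rmorph_nat (in_alg E)) c2 rmorph0.
    rewrite sqrrB xx b0 -rE -!in_algE rmorph0 rmorphXn mul0r addr0.
    by rewrite -mulr_natr c2' mulr0 subr0 -mulr2n -mulr_natr c2' mulr0.
  by move/eqP; rewrite expf_eq0 subr_eq0 /= => /eqP->; rewrite rpredZ ?mem1v.
(* Shifting creates a linear term: [(x + 1)^2 = (a - 1) + 2 (x + 1)]. *)
exists ((a - 1) / 2 ^+ 2); apply: (@quad_root_nonAS _ _ (x + 1)) => //.
  apply: contraNN xN => h; rewrite -[x](addrK 1) rpredB ?mem1v //.
rewrite sqrrD1 xx b0 -!in_algE rmorph0 rmorphB rmorph1 rmorph_nat; ring.
Qed.
End QuadraticExtension.

(** * Primality of a monic quadratic over a domain *)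

Section MonicQuadratic.
Variable R : idomainType.

Lemma size_affine_poly (c d : R) :
  (size (c%:P + d%:P * 'X : {poly R})%R <= 2)%N.
Proof.
rewrite (leq_trans (size_polyD _ _)) // geq_max (leq_trans (size_polyC_leq1 _)) //=.
rewrite (leq_trans (size_polyMleq _ _)) // size_polyX addn2 /= ltnS.
exact: size_polyC_leq1.
Qed.

Lemma size_monic_quad (a b : R) :
  size ('X ^+ 2 - a%:P * 'X + b%:P : {poly R}) = 3.
Proof.
have -> : 'X ^+ 2 - a%:P * 'X + b%:P = 'X ^+ 2 + (b%:P + (- a)%:P * 'X).
  by rewrite polyCN; ring.
by rewrite size_polyDl ?size_polyXn // ltnS size_affine_poly.
Qed.

Lemma monic_quad_monic (a b : R) : 'X ^+ 2 - a%:P * 'X + b%:P \is monic.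
Proof.
rewrite monicE lead_coefE size_monic_quad /= coefD coefB coefXn /= coefC coefCM.
by rewrite coefX /= mulr0 subr0 addr0.
Qed.

(** [u^2 + auv + bv^2] is the norm of [u + vX] modulo [g]. Norms are multiplicative, so if only 0
    has norm 0, there are no zero divisors modulo [g]. *)
Lemma monic_quad_prime (a b : R) (g := 'X ^+ 2 - a%:P * 'X + b%:P) :
    (forall u v : R, u ^+ 2 + a * u * v + b * v ^+ 2 = 0 -> v = 0) ->
  forall p q h : {poly R}, p * q = h * g ->
  exists k : {poly R}, p = k * g \/ q = k * g.
Proof.
move=> aniso p q h pq.
have szg : size g = 3 := size_monic_quad a b.
have mg : g \is monic := monic_quad_monic a b.
have red (r : {poly R}) : exists k u v, r = k * g + (u%:P + v%:P * 'X).
  have := Pdiv.RingMonic.rdivp_eq mg r; set k := Pdiv.Ring.rdivp _ _.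
  set w := Pdiv.Ring.rmodp _ _ => rE; exists k, w`_0, w`_1.
  rewrite {1}rE; congr (_ + _); apply/polyP => i.
  rewrite coefD coefC coefCM coefX; case: i => [|[|i]] /=; rewrite ?mulr0 ?mulr1 ?addr0 ?add0r //.
  rewrite nth_default // -ltnS.
  have : (size w < size g)%N by rewrite Pdiv.Ring.ltn_rmodpN0 // -size_poly_gt0 szg.
  by rewrite szg => /leq_trans ->.
have [k1 [u1 [v1 pE]]] := red p; have [k2 [u2 [v2 qE]]] := red q.
(* The product of the remainders, reduced by [X^2 = aX - b], is a multiple of [g] of degree at most
   1, hence 0. *)
have : (u1 * u2 - b * v1 * v2)%:P + (u1 * v2 + u2 * v1 + a * v1 * v2)%:P * 'X
  = (h - k1 * q - k2 * (u1%:P + v1%:P * 'X) - (v1 * v2)%:P) * g.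
  rewrite !mulrBl -pq pE qE /g !(polyCM, polyCD, polyCB, polyCN); ring.
set l := h - _ - _ - _ => lE.
have l0 : l = 0.
  apply/eqP/negPn/negP => l0.
  have := size_affine_poly (u1 * u2 - b * v1 * v2) (u1 * v2 + u2 * v1 + a * v1 * v2).
  rewrite lE size_Mmonic // szg addn3 /=.
  by rewrite -size_poly_gt0 in l0; case: (size l) l0.
move: lE; rewrite l0 mul0r => /polyP e.
have := e 0%N; have := e 1%N.
rewrite !(coefD, coefC, coefCM, coefX) /= !(mulr0, mulr1, add0r, addr0) => e1 e0 {e}.
have [v10|v10] := eqVneq v1 0.
  have [u10|u10] := eqVneq u1 0.
    by exists k1; left; rewrite pE v10 u10 mul0r !addr0.
  move: e0 e1; rewrite v10 !(mulr0, mul0r) subr0 !addr0 => /eqP.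
  rewrite mulf_eq0 (negPf u10) => /eqP u20 /eqP.
  rewrite mulf_eq0 (negPf u10) => /eqP v20.
  by exists k2; right; rewrite qE u20 v20 mul0r !addr0.
have N1 : u1 ^+ 2 + a * u1 * v1 + b * v1 ^+ 2 != 0.
  by apply: contra_neq v10; apply: aniso.
have N2 : u2 ^+ 2 + a * u2 * v2 + b * v2 ^+ 2 = 0.
  apply: (mulfI N1); rewrite mulr0.
  pose P := u1 * u2 - b * v1 * v2; pose Q := u1 * v2 + u2 * v1 + a * v1 * v2.
  transitivity (P ^+ 2 + a * P * Q + b * Q ^+ 2); first by rewrite /P /Q; ring.
  by rewrite /P /Q e0 e1; ring.
have v20 := aniso _ _ N2; move: N2; rewrite v20 !(mulr0, expr0n, addr0) => /eqP.
rewrite expf_eq0 /= => /eqP u20.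
by exists k2; right; rewrite qE v20 u20 mul0r !addr0.
Qed.
End MonicQuadratic.

(** * Anisotropy of the norm form of the curve *)

Section Anisotropic.
Variable L : fieldType.

(** By separability [p / gcd(p, w)] is coprime to the gcd, hence to [w^2], which it divides; so it
    is a unit. *)
Lemma separable_dvdp_sqr (p w : {poly L}) :
  separable_poly p -> p %| w ^+ 2 -> p %| w.
Proof.
move=> sp pw; have p0 := separable_poly_neq0 sp.
set g := gcdp p w; have gp : g %| p := dvdp_gcdl p w.
have co_zc : coprimep (p %/ g) (w %/ g) by rewrite coprimep_div_gcd ?p0.
have co_gc : coprimep (p %/ g) g by apply: (separable_coprime sp); rewrite divpK.
have : coprimep (p %/ g) (w ^+ 2).
  by rewrite coprimep_expr // -(divpK (dvdp_gcdr p w)) coprimepMr co_zc.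
have cw : p %/ g %| w ^+ 2 by apply: dvdp_trans pw; rewrite divp_dvd.
move/coprimepP/(_ _ (dvdpp _) cw) => c1.
rewrite -(divpK gp) (eqp_dvdl _ (eqp_mulr g c1)) mul1r; exact: dvdp_gcdr.
Qed.

Variables (e d : L).
Hypotheses (d0 : d != 0) (D0 : d * (1 + 4 * e) - 4 != 0).

Definition polyN : {poly L} := e%:P + 'X - 'X ^+ 2.
Definition polyM : {poly L} := d%:P * polyN - 1.

Lemma polyM_separable : separable_poly polyM.
Proof.
have dM : polyM^`() = d%:P * (1 - 'X *+ 2).
  by rewrite /polyM /polyN !derivE add0r subr0 expr1.
rewrite unlock dM; apply/Bezout_eq1_coprimepP.
(* The inverse of the discriminant of [M]; the Bezout identity is
   [4d M + d (1 - 2X) M' = disc M]. *)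
pose c := (d * (d * (1 + 4 * e) - 4))^-1.
have cE : c * (d * (d * (1 + 4 * e) - 4)) = 1 by rewrite mulVf // mulf_neq0.
exists (c%:P * (4 * d)%:P, c%:P * d%:P * (1 - 'X *+ 2)) => /=.
have c4 : (4 : L)%:P = 4 :> {poly L} by exact: (rmorph_nat polyC).
have := congr1 polyC cE; rewrite !polyCM polyCB polyCM polyCD polyCM c4 polyC1.
by move=> h; rewrite -[RHS]h /polyM /polyN; ring.
Qed.

Lemma size_polyM : size polyM = 3.
Proof.
have -> : polyM = - d%:P * 'X^2 + (d%:P * 'X + (d * e - 1)%:P).
  by rewrite /polyM /polyN polyCB polyCM polyC1; ring.
rewrite size_polyDl -polyCN size_Cmul ?oppr_eq0 // size_polyXn //.
rewrite ltnS (leq_trans (size_polyD _ _)) // geq_max.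
by rewrite size_Cmul // size_polyX /= (leq_trans (size_polyC_leq1 _)).
Qed.

(** An Eisenstein-type argument. For coprime [u], [v], the equation makes [v] a unit, and [M]
    divides [u^2], hence [u]. Dividing by [M] shows that [M] divides [N]; as [M = dN - 1], it would
    divide 1. *)
Lemma curve_anisotropic (u v : {poly L}) :
  u ^+ 2 + polyM * u * v + (polyN * polyM - e%:P * polyM ^+ 2) * v ^+ 2 = 0 ->
  v = 0.
Proof.
move=> h; apply/eqP/negPn/negP => v0.
have [g [u' [v' [g0 co uE vE]]]] : exists g u' v' : {poly L},
    [/\ g != 0, coprimep u' v', u = u' * g & v = v' * g].
  exists (gcdp u v), (u %/ gcdp u v), (v %/ gcdp u v).
  rewrite !divpK ?dvdp_gcdl ?dvdp_gcdr // gcdp_eq0 (negPf v0) andbF.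
  by split=> //; rewrite coprimep_div_gcd ?v0 ?orbT.
move: h; rewrite {}uE {}vE => {u v v0} h; move: u' v' co h => u v co h.
have {g g0}h : u ^+ 2 + polyM * u * v
    + (polyN * polyM - e%:P * polyM ^+ 2) * v ^+ 2 = 0.
  by apply: (mulIf (expf_neq0 2 g0)); rewrite mul0r -[RHS]h; ring.
have v1 : v %= 1.
  have vu : v %| u ^+ 2.
    apply/dvdpP; exists (- (polyM * u
      + (polyN * polyM - e%:P * polyM ^+ 2) * v)).
    by apply/eqP; rewrite -subr_eq0 -h; apply/eqP; ring.
  by have /coprimepP := coprimep_expl 2 co; apply.
have Mu : polyM %| u.
  apply: separable_dvdp_sqr polyM_separable _; apply/dvdpP.
  exists (- (u * v + (polyN - e%:P * polyM) * v ^+ 2)).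
  by apply/eqP; rewrite -subr_eq0 -h; apply/eqP; ring.
case/dvdpP: Mu => z uE; rewrite {}uE in h.
have M0 : polyM != 0 by rewrite -size_poly_gt0 size_polyM.
have : polyM %| polyN * v ^+ 2.
  apply/dvdpP; exists (- (z ^+ 2 + z * v - e%:P * v ^+ 2)).
  apply: (mulfI M0); apply/eqP; rewrite -subr_eq0 -h; apply/eqP; ring.
rewrite (eqp_dvdr _ (eqp_mull _ (eqp_exp 2 v1))) expr1n mulr1 => MN.
have : polyM %| 1.
  have -> : 1 = d%:P * polyN - polyM by rewrite /polyM; ring.
  by rewrite dvdp_sub ?dvdp_mull.
by rewrite dvdp1 size_polyM.
Qed.

End Anisotropic.

(** * The curve in two variables and its absolute irreducibility *)

Section Bivariate.
Variable L : fieldType.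

(** The first variable moves into the coefficients, so that the curve becomes a monic quadratic in
    the second. *)
Definition to_bipoly : {mpoly L[2]} -> {poly {poly L}} :=
  mmap (polyC \o polyC) (fun i : 'I_2 => if i == ord0 then 'X%:P else 'X).
HB.instance Definition _ := GRing.RMorphism.on to_bipoly.

Definition of_upoly : {poly L} -> {mpoly L[2]} :=
  horner_morph (fun a => mulrC ('X_ord0 : {mpoly L[2]}) (mpolyC 2 a)).
HB.instance Definition _ := GRing.RMorphism.on of_upoly.
Definition of_bipoly : {poly {poly L}} -> {mpoly L[2]} :=
  horner_morph (fun a => mulrC ('X_ord_max : {mpoly L[2]}) (of_upoly a)).
HB.instance Definition _ := GRing.RMorphism.on of_bipoly.

Lemma to_bipolyC c : to_bipoly c%:MP = c%:P%:P.
Proof. exact: mmapC. Qed.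

Lemma to_bipolyX0 : to_bipoly 'X_ord0 = 'X%:P.
Proof. by rewrite /to_bipoly mmapX mmap1U eqxx. Qed.

Lemma to_bipolyX1 : to_bipoly 'X_ord_max = 'X.
Proof. by rewrite /to_bipoly mmapX mmap1U. Qed.

Lemma of_bipolyX (i : 'I_2) : of_bipoly (if i == ord0 then 'X%:P else 'X) = 'X_i.
Proof.
have [->|/eqP i0] := eqVneq i ord0; rewrite /of_bipoly /=.
  by rewrite horner_morphC /= /of_upoly horner_morphX.
rewrite horner_morphX; congr 'X__; apply: val_inj.
by case: i i0 => -[|[|//]] //= h []; apply: val_inj.
Qed.

Lemma to_bipolyK : cancel to_bipoly of_bipoly.
Proof.
move=> p; rewrite [RHS]mpolyE /to_bipoly /mmap rmorph_sum /=.
apply: eq_bigr => m _; rewrite -mul_mpolyC rmorphM /=.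
rewrite {1}/of_bipoly horner_morphC /= /of_upoly horner_morphC /=; congr (_ * _).
rewrite /mmap1 rmorph_prod mpolyXE_id /=.
by apply: eq_bigr => i _; rewrite rmorphXn /= of_bipolyX.
Qed.

End Bivariate.

Definition mpolyN (L : fieldType) (e : L) : {mpoly L[2]} :=
  e%:MP + 'X_ord0 - 'X_ord0 ^+ 2.
Definition mpolyM (L : fieldType) (e d : L) : {mpoly L[2]} :=
  d%:MP * mpolyN e - 1.
(** With [M = dN - 1], the equation [1/N(t) + 1/N(r) = d] says [N(r) = N/M]; put [r = w/M] and
    multiply by [M^2]. *)
Definition curve (L : fieldType) (e d : L) : {mpoly L[2]} :=
  'X_ord_max ^+ 2 - mpolyM e d * 'X_ord_max
  + (mpolyN e * mpolyM e d - e%:MP * mpolyM e d ^+ 2).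

Lemma to_bipoly_curve (L : fieldType) (e d : L) :
  to_bipoly (curve e d) =
  'X ^+ 2 - (polyM e d)%:P * 'X
  + (polyN e * polyM e d - e%:P * polyM e d ^+ 2)%:P.
Proof.
have NE : to_bipoly (mpolyN e) = (polyN e)%:P.
  rewrite /mpolyN /polyN rmorphB rmorphD rmorphXn /= to_bipolyC to_bipolyX0.
  by rewrite polyCB polyCD polyC_exp.
have ME : to_bipoly (mpolyM e d) = (polyM e d)%:P.
  rewrite /mpolyM /polyM rmorphB rmorphM rmorph1 /= NE to_bipolyC.
  by rewrite [RHS]polyCB polyCM polyC1.
rewrite /curve.
move: (mpolyM e d) (mpolyN e) (polyM e d) (polyN e) ME NE => M N m n ME NE.
by rewrite rmorphD !rmorphB !(rmorphXn, rmorphM) /= ME NE to_bipolyC to_bipolyX1.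
Qed.

Lemma map_curve (F L : fieldType) (iota : {rmorphism F -> L}) (e d : F) :
  map_mpoly iota (curve e d) = curve (iota e) (iota d).
Proof.
have NE : map_mpoly iota (mpolyN e) = mpolyN (iota e).
  by rewrite /mpolyN rmorphB rmorphD rmorphXn /= map_mpolyC map_mpolyX.
have ME : map_mpoly iota (mpolyM e d) = mpolyM (iota e) (iota d).
  by rewrite /mpolyM rmorphB rmorphM rmorph1 /= NE map_mpolyC.
rewrite /curve -{}NE -{}ME.
move: (mpolyM e d) (mpolyN e) => M N.
rewrite rmorphD !rmorphB !(rmorphXn, rmorphM) /=.
by rewrite map_mpolyC map_mpolyX.
Qed.

Lemma meval_curve (L : fieldType) (e d : L) (x : 'I_2 -> L)
    (N := e + x ord0 - x ord0 ^+ 2) (M := d * N - 1) :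
  (curve e d).@[x] = x ord_max ^+ 2 - M * x ord_max + (N * M - e * M ^+ 2).
Proof.
rewrite /M /N /curve /mpolyM /mpolyN.
rewrite !(mevalB, mevalD, mevalN, mevalM, mevalXU, mevalC, meval1) /=.
ring.
Qed.

Lemma in_principal_ideal (L : fieldType) n (f p : {mpoly L[n]}) :
  in_ideal [:: f] p <-> exists h, p = h * f.
Proof.
split=> [[gs ->]|[h ->]]; last by exists (fun=> h); rewrite big_ord1.
by exists (gs ord0); rewrite big_ord1.
Qed.

(** Both conditions survive field embeddings, so this covers every base change. *)
Lemma curve_prime (L : fieldType) (e d : L) :
  d != 0 -> d * (1 + 4 * e) - 4 != 0 -> prime_ideal [:: curve e d].
Proof.
move=> d0 D0; have gE := to_bipoly_curve e d; split=> [|p q].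
  case/in_principal_ideal=> h /(congr1 (@to_bipoly L)).
  rewrite rmorph1 rmorphM /= gE => /(congr1 (fun p : {poly _} => size p)).
  have [->|h0] := eqVneq (to_bipoly h) 0; first by rewrite mul0r size_poly0 size_poly1.
  rewrite size_poly1 size_Mmonic ?monic_quad_monic // size_monic_quad addn3 /=.
  by rewrite -size_poly_gt0 in h0; case: (size (to_bipoly h)) h0.
case/in_principal_ideal=> h /(congr1 (@to_bipoly L)); rewrite !rmorphM /= gE.
case/(monic_quad_prime (curve_anisotropic d0 D0)) => k.
by case; rewrite -gE => /(congr1 (@of_bipoly L)); rewrite rmorphM /= !to_bipolyK;
  [left|right]; apply/in_principal_ideal; exists (of_bipoly k).
Qed.

(** * Pseudo-finite residue fields: a rational point *)

Section PseudoFinite.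
Variable F : fieldType.

Lemma pac_good_sums (e : F) : pac_field F -> ~ P2AS e -> good_sums F.
Proof.
move=> pacF eP g; have A0 := nonAS_disc_neq0 eP.
(* The exceptional values: [g = -8] gives [d = 0], and [d (1 + 4e) - 4 = g + 4]. *)
have [->|g8] := eqVneq g (-4 + -4).
  by exists (-4), (-4); split=> //; apply: goodN4.
have [->|g4] := eqVneq g (-4).
  by exists 0, (-4); rewrite add0r; split=> //; [exact: Or31|exact: goodN4].
pose d := (g + 8) / (1 + 4 * e).
have d0 : d != 0.
  rewrite mulf_neq0 ?invr_eq0 //; apply: contra_neq g8 => h.
  by rewrite -[g](addrK 8) h; ring.
have D0 : d * (1 + 4 * e) - 4 != 0.
  rewrite /d divfK //; apply: contra_neq g4 => h.
  by rewrite -[g](addrK 8) -[g + 8](subrK 4) h; ring.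
have [|x /(_ _ (mem_head _ _))] := pacF 2%N [:: curve e d].
  move=> L iota; rewrite /= map_curve; apply: curve_prime.
    by rewrite fmorph_eq0.
  suff -> : iota d * (1 + 4 * iota e) - 4 = iota (d * (1 + 4 * e) - 4).
    by rewrite fmorph_eq0.
  by move: (d) => c; rewrite rmorphB rmorph_nat rmorphM rmorphD rmorph1 rmorphM rmorph_nat.
rewrite meval_curve.
move: (x ord0) (x ord_max) => t w.
have N0 := nonAS_quad_neq0 t eP; set N := e + t - t ^+ 2 in N0 *.
(* If [M] vanishes at [t], then [r] is infinite and the second summand is [-4]. *)
have [M0|M0] := eqVneq (d * N - 1) 0 => h.
  exists (conic e t), (-4); split; [exact: good_conic|exact: goodN4|].
  have -> : conic e t = (1 + 4 * e) * d - 4.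
    rewrite /conic -/N; congr (_ * _ - _); apply: (mulIf N0).
    by rewrite mulVf //; apply/esym/eqP; rewrite -subr_eq0 M0.
  by rewrite /d; field.
pose r := w / (d * N - 1); have R0 := nonAS_quad_neq0 r eP.
have RE : e + r - r ^+ 2 = N / (d * N - 1).
  apply: (mulIf (expf_neq0 2 M0)); apply/eqP; rewrite -subr_eq0 -oppr_eq0 -h.
  by rewrite /r; apply/eqP; field.
exists (conic e t), (conic e r); split; try exact: good_conic.
have -> : g = d * (1 + 4 * e) - 8 by rewrite /d; field.
by rewrite /conic -/N RE; move: (d) M0 => c M0; field; rewrite N0 M0.
Qed.

Lemma pseudo_finite_nonAS : pseudo_finite F -> exists e : F, ~ P2AS e.
Proof.
case=> _ perfF _ /(_ 2%N isT) [[E dimE] _]; exact: quadratic_extension_nonAS dimE.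
Qed.

Lemma residue_good_sums : finite_field F \/ pseudo_finite F ->
  (exists e : F, ~ P2AS e) /\ good_sums F.
Proof.
case=> [finF|pfF]; first by split; [exact: finite_nonAS|exact: finite_good_sums].
have [e eP] := pseudo_finite_nonAS pfF; split; first by exists e.
by case: pfF => _ _ pacF _; apply: pac_good_sums pacF eP.
Qed.

End PseudoFinite.

(** * Lifting good elements to the valuation ring *)

Section Valuation.
Variables (K : fieldType) (G : orderedZmodType) (v : valuation K G).
Implicit Types (x y : K) (a : valuation_ring v).

Lemma vring_invr x : x \notin vmax v -> x^-1 \in vring v.
Proof.
rewrite !inE negb_or => /andP[x0]; rewrite -comparable_leNgt ?vcomparable // => vx.
rewrite invr_eq0 (negPf x0) valV //= -(leD2l (v x)) subrr addr0 //.
Qed.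

Lemma vmax_sub_vring x : x \in vmax v -> x \in vring v.
Proof. by rewrite !inE => /orP[->|/ltW ->] //; rewrite orbT. Qed.

(** A case of integral closedness; it lets Artin-Schreier roots be reduced to the residue field. *)
Lemma vring_AS y : y ^+ 2 + y \in vring v -> y \in vring v.
Proof.
move=> h; have [/vmax_sub_vring//|ym] := boolP (y \in vmax v).
have y0 : y != 0 by apply: contraNneq ym => ->; rewrite inE eqxx.
have -> : y = (y ^+ 2 + y) * y^-1 - 1 by field.
by rewrite rpredB ?rpredM ?rpred1 ?vring_invr.
Qed.

(** Modulo the maximal ideal, [T^2 + T - x] has the simple root 0, its derivative there being 1. *)
Lemma henselian_vmax_AS x : henselian v -> x \in vmax v -> P2AS x.
Proof.
move=> hens xm; have [||||b [_ fb _]] := hens ('X ^+ 2 + 'X - x%:P) 0.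
- by rewrite rpredB ?rpredD ?rpredX ?polyOverX // polyOverC vmax_sub_vring.
- exact: rpred0.
- rewrite !hornerE expr0n add0r.
  by move: xm; rewrite !inE oppr_eq0 valN.
- rewrite !derivE !hornerE /= subr0.
  by rewrite inE oner_eq0 Defs.val1 ltxx.
by exists b; move/eqP: fb; rewrite !hornerE subr_eq0 eq_sym => /eqP.
Qed.

Lemma good_vring s : henselian v -> good s -> s \in vring v.
Proof.
move=> hens [->|->|[n sn nP]]; first exact: rpred0.
  by rewrite rpredN !rpredD ?rpred1.
have -> : s = n^-1.
  have n0 : n != 0 by apply: contra_eq_neq sn => ->; rewrite mulr0 eq_sym oner_eq0.
  by apply: (mulIf n0); rewrite sn mulVf.
by apply: vring_invr; apply/negP => /(henselian_vmax_AS hens).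
Qed.

Definition residue (a : valuation_ring v) : residue_field v :=
  \pi_({ideal_quot (vmax_ideal (v := v))})%qT a.

Fact residue_is_zmod_morphism : zmod_morphism residue.
Proof.
by move=> a b; apply: (rmorphB \pi_({ideal_quot (vmax_ideal (v := v))})%qT).
Qed.

Fact residue_is_monoid_morphism : monoid_morphism residue.
Proof.
split; first exact: (rmorph1 \pi_({ideal_quot (vmax_ideal (v := v))})%qT).
by move=> a b; apply: (rmorphM \pi_({ideal_quot (vmax_ideal (v := v))})%qT).
Qed.

HB.instance Definition _ := GRing.isZmodMorphism.Build
  (valuation_ring v) (residue_field v) residue residue_is_zmod_morphism.
HB.instance Definition _ := GRing.isMonoidMorphism.Build
  (valuation_ring v) (residue_field v) residue residue_is_monoid_morphism.

Lemma residue_eq0 a : (residue a == 0) = (vring_val a \in vmax v).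
Proof.
rewrite -(rmorph0 residue) -[LHS]Quotient.idealrBE subr0 //.
Qed.

Lemma residue_surj (g : residue_field v) : exists a, residue a = g.
Proof. by exists (repr g); apply: reprK. Qed.

Lemma residue_nonAS a : ~ P2AS (residue a) -> ~ P2AS (vring_val a).
Proof.
move=> aP [y yE]; apply: aP.
have yV : y \in vring v by apply: vring_AS; rewrite -yE vring_valP.
exists (residue (VRing yV)); rewrite -rmorphXn -rmorphD; congr (residue _).
exact: val_inj.
Qed.

(** The hypothesis concerns only the residue, so [a] may be moved by any element of the maximal
    ideal. *)
Lemma good_lift_inv (a : valuation_ring v) (n : residue_field v) :
  residue a * n = 1 -> ~ P2AS n -> good (vring_val a).
Proof.
move=> an nP.
have am : vring_val a \notin vmax v.
  rewrite -residue_eq0; apply: contra_eq_neq an => ->.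
  by rewrite mul0r eq_sym oner_eq0.
have a0 : vring_val a != 0 by apply: contraNneq am => ->; rewrite inE eqxx.
pose b := VRing (vring_invr am); apply: Or33; exists (vring_val b).
  by rewrite /= divff.
apply: residue_nonAS; suff -> : residue b = n by [].
have ab : residue a * residue b = 1.
  by rewrite -rmorphM -(rmorph1 residue); congr residue; apply: val_inj; rewrite /= divff.
by rewrite -[residue b]mul1r -an mulrAC ab mul1r.
Qed.

Lemma good_lift (g : residue_field v) :
  good g -> exists2 a, good (vring_val a) & residue a = g.
Proof.
case=> [->|->|[n gn nP]].
- by exists 0; [exact: Or31|exact: rmorph0].
- exists (- (1 + 1 + 1 + 1)); first exact: Or32.
  by rewrite rmorphN !rmorphD !rmorph1.
have [a aE] := residue_surj g; exists a => //.
by apply: good_lift_inv nP; rewrite aE.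
Qed.

Lemma vmax_good_sub x : (exists e : residue_field v, ~ P2AS e) ->
  x \in vmax v -> exists s1 s2, [/\ good s1, good s2 & x = s1 - s2].
Proof.
move=> [e eP] xm.
have e0 : e != 0 by apply/eqP => e0; apply: eP; exists 0; rewrite e0; ring.
have [a aE] := residue_surj e^-1; pose b := VRing (vmax_sub_vring xm).
exists (vring_val (a + b)), (vring_val a); split.
- apply: good_lift_inv eP; rewrite rmorphD /=.
  have /eqP-> : residue b == 0 by rewrite residue_eq0.
  by rewrite addr0 aE mulVf.
- by apply: good_lift_inv eP; rewrite aE mulVf.
- by rewrite /= addrC addKr.
Qed.

Lemma vring_good x : henselian v -> (exists e : residue_field v, ~ P2AS e) ->
  good_sums (residue_field v) ->
  x \in vring v <-> exists s1 s2 s3 s4,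
    [/\ good s1, good s2, good s3 & good s4] /\ x = s1 + s2 + (s3 - s4).
Proof.
move=> hens nAS sums; split=> [xV|[s1 [s2 [s3 [s4 [[h1 h2 h3 h4] ->]]]]]]; last first.
  by apply: rpredD; [apply: rpredD|apply: rpredB]; apply: good_vring.
have [_ [_ [/good_lift[a1 g1 <-] /good_lift[a2 g2 <-]]]] := sums (residue (VRing xV)).
rewrite -rmorphD => /eqP; rewrite -subr_eq0 -rmorphB residue_eq0.
case/(vmax_good_sub nAS)=> s3 [s4 [g3 g4 h]].
exists (vring_val a1), (vring_val a2), s3, s4; split=> //.
by rewrite -h /= addrC subrK.
Qed.

End Valuation.

(** * The existential formula *)

(** Variables 0 to 3 are the summands, 4 to 7 the corresponding [n], quantified in front to give
    prenex form. *)
Definition vring_formula : ex_formula :=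
  let s (i : nat) := TVar (Some (inord i)) : term (option 'I_8) in
  let n (i : nat) := TVar (Some (inord (4 + i))) : term (option 'I_8) in
  let four := let one := TOne _ in TAdd (TAdd (TAdd one one) one) one in
  let goodf i := QOr (QEq (s i) (TZero _)) (QOr (QEq (s i) (TOpp four))
    (QAnd (QEq (TMul (s i) (n i)) (TOne _)) (QNot (QAS (n i))))) in
  ExFormula (QAnd (QAnd (QAnd (goodf 0%N) (goodf 1%N))
                        (QAnd (goodf 2%N) (goodf 3%N)))
    (QEq (TVar None) (TAdd (TAdd (s 0%N) (s 1%N)) (TAdd (s 2%N) (TOpp (s 3%N)))))).

Lemma vring_formulaP (K : fieldType) (x : K) :
  ex_holds vring_formula x <-> exists s1 s2 s3 s4,
    [/\ good s1, good s2, good s3 & good s4] /\ x = s1 + s2 + (s3 - s4).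
Proof.
(* The quantifier on [n] is pulled out of the disjunction; in the first two cases 0 is a dummy
   witness. *)
have goodE (s : K) : good s <->
    exists n, s = 0 \/ (s = - (1 + 1 + 1 + 1) \/ (s * n = 1 /\ ~ P2AS n)).
  split=> [[->|->|[n sn nP]]|[n [|[|[]]]]].
  - by exists 0; left.
  - by exists 0; right; left.
  - by exists n; right; right.
  - exact: Or31.
  - exact: Or32.
  - by move=> sn nP; apply: Or33; exists n.
split=> [[y /= [[[h0 h1] [h2 h3]] hx]]|].
  exists (y (inord 0)), (y (inord 1)), (y (inord 2)), (y (inord 3)).
  by split=> //; split; apply/goodE; eexists; eassumption.
case=> s1 [s2 [s3 [s4 [[/goodE[n1 h1] /goodE[n2 h2] /goodE[n3 h3] /goodE[n4 h4]] ->]]]].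
exists (fun i => nth 0 [:: s1; s2; s3; s4; n1; n2; n3; n4] i) => /=.
by rewrite !inordK.
Qed.

Theorem theorem1p2 :
  exists phi : ex_formula,
    forall (K : fieldType) (G : orderedZmodType) (v : valuation K G),
      nontrivial_valuation v ->
      henselian v ->
      finite_field (residue_field v) \/ pseudo_finite (residue_field v) ->
      forall x : K, x \in vring v <-> ex_holds phi x.
Proof.
exists vring_formula => K G v _ hens res x.
have [nAS sums] := residue_good_sums res.
exact: iff_trans (vring_good x hens nAS sums) (iff_sym (vring_formulaP x)).
Qed.
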